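(* Let $\lambda$ be a strict partition of $n$. The restricted dual equivalences $d_i^R$, $i\in[2,n-2]$, act transitively on $\mathrm{SSYT}(\lambda)$ via the flip of the row reading word: for each $T\in\mathrm{SSYT}(\lambda)$ there is a unique $T'\in\mathrm{SSYT}(\lambda)$ with $\mathrm{flip}(\mathrm{rw}(T'))=d_i^R(\mathrm{flip}(\mathrm{rw}(T)))$, and any two elements of $\mathrm{SSYT}(\lambda)$ are connected by a finite sequence of such moves $T\mapsto T'$.
   Context: A strict partition is $\lambda=(\lambda_1>\lambda_2>\dots>\lambda_k>0)$. Its shifted shape is the set of squares in row $r$ and column $c$ with $1\le r\le k$ and $r\le c\le\lambda_r+r-1$, with rows numbered from bottom to top. $\mathrm{SSYT}(\lambda)$ here denotes the set of standard shifted tableaux of shifted shape $\lambda$: fillings of the shifted shape using each of $1,\dots,n$ once, increasing left to right along rows and bottom to top up columns. The row reading word $\mathrm{rw}(T)$ reads each row left to right, starting with the top row and going down. Permutations are in one-line notation. $\mathrm{ID}(\pi)$ is the set of $i\in[n-1]$ such that $i$ occurs to the right of $i+1$. $\mathrm{flip}(\pi)$ is obtained by reading $\pi$ from right to left and then replacing each value $v$ by $n+1-v$. $d_i$ acts on a permutation by: $\ldots i\ldots i-1\ldots i+1\ldots\leftrightarrow\ldots i+1\ldots i-1\ldots i\ldots$ and $\ldots i\ldots i+1\ldots i-1\ldots\leftrightarrow\ldots i-1\ldots i+1\ldots i\ldots$ (all else fixed), and as the identity if $i$ is between $i-1$ and $i+1$. For $i\in[2,n-2]$, $d_i^R(\pi)=\pi$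 if $i+1\in\mathrm{ID}(\pi)\cap\mathrm{ID}(d_i(\pi))$, and $d_i^R(\pi)=d_i(\pi)$ otherwise. *)

(* Defs.v *)
From mathcomp Require Import all_boot.
From Stdlib Require Export Relation_Operators.

Set Implicit Arguments.
Unset Strict Implicit.
Unset Printing Implicit Defensive.

Definition strict_partition (n : nat) (lam : seq nat) : Prop :=
  [/\ sorted gtn lam, all (fun m => 0 < m) lam & sumn lam = n].

(* Rows and columns are numbered from 1, rows from bottom to top. *)
Definition in_shifted_shape (lam : seq nat) (r c : nat) : bool :=
  (1 <= r <= size lam) && (r <= c <= nth 0 lam r.-1 + r - 1).

(* A filling is the list of its rows, bottom row first.  Row r starts in
   column r, so the entry in column c is the one of index c - r in the row. *)
Definition entry (T : seq (seq nat)) (r c : nat) : nat :=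
  nth 0 (nth [::] T r.-1) (c - r).

(* Standard shifted tableaux of shifted shape lam. *)
Definition SSYT (lam : seq nat) (T : seq (seq nat)) : Prop :=
  [/\ shape T = lam,
      perm_eq (flatten T) (iota 1 (sumn lam)),
      forall r c, in_shifted_shape lam r c -> in_shifted_shape lam r c.+1 ->
        entry T r c < entry T r c.+1
    & forall r c, in_shifted_shape lam r c -> in_shifted_shape lam r.+1 c ->
        entry T r c < entry T r.+1 c].

Definition rw (T : seq (seq nat)) : seq nat := flatten (rev T).

(* A permutation of [n] is represented by its one-line notation, a word w of
   size n using each of 1, ..., n once; index v w is the position of v. *)
Definition ID (w : seq nat) : pred nat :=
  [pred i | (1 <= i <= size w - 1) && (index i.+1 w < index i w)].

Definition flip (w : seq nat) : seq nat :=
  [seq size w + 1 - v | v <- rev w].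

Definition swap_values (x y : nat) (w : seq nat) : seq nat :=
  [seq (if v == x then y else if v == y then x else v) | v <- w].

Definition between (p q r : nat) : bool := (p < q < r) || (r < q < p).

Definition d (i : nat) (w : seq nat) : seq nat :=
  if between (index i w) (index i.-1 w) (index i.+1 w)
  then swap_values i i.+1 w
  else if between (index i w) (index i.+1 w) (index i.-1 w)
  then swap_values i.-1 i w
  else w.

Definition dR (i : nat) (w : seq nat) : seq nat :=
  if (i.+1 \in ID w) && (i.+1 \in ID (d i w)) then w else d i w.

Definition dR_image (lam : seq nat) (i : nat) (T T' : seq (seq nat)) : Prop :=
  SSYT lam T' /\ flip (rw T') = dR i (flip (rw T)).

Definition dR_move (lam : seq nat) (T T' : seq (seq nat)) : Prop :=
  SSYT lam T /\
  exists2 i, 2 <= i <= sumn lam - 2 & dR_image lam i T T'.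

(* Main.v *)
Require Import Defs.
From mathcomp Require Import all_boot zify.

(* Encode a standard shifted tableau T with n cells as the word t whose u-th
   letter is the row of the entry n + 1 - u.  The tableaux correspond to the
   words all of whose suffixes have strict content, flip (rw T) is the inverse
   of the standardization of t, and d_i^R becomes a Knuth relation on the
   letters i-1, i, i+1 of t, blocked by a condition on the letter i+2.  The only
   way a Knuth relation can break strictness is to exchange x y z = (r+1) r r,
   and then the letters after them are all smaller than r, so the move is blocked.
   Transitivity is by induction on n: words with the same first letter are
   connected by induction, and a word connecting two different first letters is
   built explicitly in good_bridge. *)

Set Implicit Arguments.
Unset Strict Implicit.
Unset Printing Implicit Defensive.

(** * Words all of whose suffixes have strict content *)

(* The multiplicities of 0, 1, 2, ... form a strict partition. *)
Definition strict (t : seq nat) : Prop :=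
  forall r, count_mem r.+1 t = 0 \/ count_mem r.+1 t < count_mem r t.

Fixpoint good (t : seq nat) : Prop :=
  if t is _ :: t' then strict t /\ good t' else True.

Lemma good_strict t : good t -> strict t.
Proof. by case: t => [|x t] /=; [left | case]. Qed.

Lemma perm_strict s t : perm_eq s t -> strict s -> strict t.
Proof. by move/permP=> st ss r; rewrite -!st. Qed.

Lemma goodP t : good t <-> forall k, strict (drop k t).
Proof.
split=> [|gt].
  elim: t => [|x t IHt] gt [|k] //=; try by left.
    by case: gt.
  by apply: IHt; case: gt.
elim: t gt => //= x t IHt gt; split; first exact: (gt 0).
by apply: IHt => k; apply: (gt k.+1).
Qed.

(** Suffixes that begin inside [p] change only by a permutation, which strictness ignores; all
    others are suffixes of [s']. *)
Lemma good_cat_perm p s s' :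
  perm_eq s s' -> good s' -> good (p ++ s) -> good (p ++ s').
Proof.
move=> ss' gs'; elim: p => //= x p IHp [sx gp]; split; last exact: IHp.
by apply: perm_strict sx; rewrite perm_cons perm_cat2l.
Qed.

Lemma good_catr p s : good (p ++ s) -> good s.
Proof. by elim: p => //= x p IHp [_ /IHp]. Qed.

(** * Restricted Knuth moves and their effect on good words *)

Lemma strict0 t r k :
  strict t -> count_mem r t = 0 -> r <= k -> count_mem k t = 0.
Proof.
move=> st r0 /subnK <-; elim: (k - r) => [|m IHm] //.
by have := st (m + r); rewrite addSn; lia.
Qed.

(** Weak inequalities appear because equal letters count as increasing from left to right. The
    conditions on [u] compare it with the letter in front of it, before and after the exchange; they
    express that i+1 lies in both inverse descent sets. *)
Definition restricted_knuth x y z u : seq nat :=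
  if ((y < x <= z) || (z < x <= y)) && ~~ ((u < z) && (u < y))
  then [:: x; z; y; u]
  else if ((y <= z < x) || (x <= z < y)) && ~~ (u < z)
  then [:: y; x; z; u]
  else [:: x; y; z; u].

Lemma perm_restricted_knuth x y z u :
  perm_eq [:: x; y; z; u] (restricted_knuth x y z u).
Proof.
by rewrite /restricted_knuth; case: ifP => _; last case: ifP => _ //;
  apply/permP => a /=; lia.
Qed.

(** Exchanging [x] and [y] creates one new suffix, [x :: s]. Leaving out [y] can only hurt when [y]
    names the row just below that of [x], and the last premise covers this case. *)
Lemma strict_exchange x y s :
    strict s -> strict [:: x, y & s] -> x != y ->
    (x = y.+1 -> (count_mem x s).+1 < count_mem y s) ->
  strict (x :: s).
Proof.
move=> ss sxy nxy exy r; have /= := sxy r; have := ss r.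
have [exr|nxr] := eqVneq x r.+1; last by rewrite /=; lia.
have [eyr|nyr] := eqVneq y r.
  by have := exy; rewrite exr eyr => /(_ erefl) /=; lia.
by rewrite /=; lia.
Qed.

Lemma good_restricted_knuth x y z u q :
  good [:: x, y, z, u & q] -> good (restricted_knuth x y z u ++ q).
Proof.
rewrite /restricted_knuth => gt.
case: gt => sx [sy [sz [su gq]]].
case: ifP => [H|_]; last case: ifP => [H|_] //.
- rewrite /=; split; first by apply: perm_strict sx; apply/permP => a /=; lia.
  split; first by apply: perm_strict sy; apply/permP => a /=; lia.
  split=> //; apply: (strict_exchange su sy) => [|yz]; first lia.
  (* If [y] is [z.+1], then [x] equals [y], and strictness of the whole word, which has two copies
     of [z.+1] and one of [z] in front of [u :: q], leaves enough room. *)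
  by have := sx z; (have xy : x = y by lia); subst x y; rewrite /=; lia.
- rewrite /=; split; first by apply: perm_strict sx; apply/permP => a /=; lia.
  split=> //; apply: (strict_exchange sz sx) => [|xy]; first lia.
  have [zy zu] : z = y /\ z <= u by lia.
  subst x z; have := sx y; rewrite /= => sxy.
  (* Strictness of the whole word allows equality here, but equality would make both counts zero, so
     that no letter of [u :: q] could be [y] or larger, against [z <= u]. This is where the
     restriction is needed. *)
  have : count_mem y (u :: q) <> count_mem y.+1 (u :: q).
    move=> e; have y0 : count_mem y (u :: q) = 0 by have := su y; rewrite e; lia.
    by have := strict0 su y0 zu; rewrite /=; lia.
  by rewrite /=; lia.
Qed.

Inductive knuth_step : seq nat -> seq nat -> Prop :=
  KnuthStep p x y z u q :
    knuth_step (p ++ [:: x, y, z, u & q]) (p ++ restricted_knuth x y z u ++ q).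

Lemma perm_knuth_step t t' : knuth_step t t' -> perm_eq t t'.
Proof.
case=> p x y z u q.
by rewrite perm_cat2l (perm_cat2r q [:: x; y; z; u]) perm_restricted_knuth.
Qed.

Lemma good_knuth_step t t' : knuth_step t t' -> good t -> good t'.
Proof.
case=> p x y z u q gt; apply: good_cat_perm (gt).
  by rewrite (perm_cat2r q [:: x; y; z; u]) perm_restricted_knuth.
by apply: good_restricted_knuth; apply: good_catr gt.
Qed.

(** * Connectedness of good words of equal content *)

Definition knuth_connected := clos_refl_trans (seq nat) knuth_step.

Lemma knuth_connected_cons a t t' :
  knuth_connected t t' -> knuth_connected (a :: t) (a :: t').
Proof.
elim=> [s s' [p x y z u q]|s|s s' s'' _ H _ H'].
- exact/rt_step/(KnuthStep (a :: p)).
- exact: rt_refl.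
- exact: rt_trans H H'.
Qed.

(** The largest letter names the topmost row, and shortening it cannot break strictness since no row
    lies above it. *)
Lemma strict_behead_max d s :
  strict (d :: s) -> (forall x, x \in s -> x <= d) -> strict s.
Proof.
move=> sd maxd r; have /= := sd r; have [e|] := eqVneq d r; last by lia.
left; apply/count_memPn; apply/negP => /maxd; lia.
Qed.

Lemma strict_max s : strict s -> 0 < size s ->
  exists d s', [/\ perm_eq s (d :: s'), strict s' & forall x, x \in s -> x <= d].
Proof.
move=> ss s0; set d := \max_(x <- s) x.
have maxd x : x \in s -> x <= d by move=> xs; rewrite /d (big_rem x) //= leq_maxl.
have ds : d \in s.
  rewrite /d; case: (s) s0 => // x s1 _; elim: s1 x => [|y s1 IHs] x.
    by rewrite big_seq1 inE.
  rewrite big_cons inE; have := IHs y; set m := bigop _ _ _.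
  by case: (leqP x m) => _ ym; rewrite ?eqxx // ym orbT.
exists d, (rem d s); split=> //; first exact: perm_to_rem.
apply: (@strict_behead_max d); first by apply: perm_strict ss; apply: perm_to_rem.
by move=> x /mem_rem /maxd.
Qed.

(** Greedy choice: always read the largest remaining letter first, which empties the rows from the
    top. *)
Lemma good_exists s : strict s -> exists2 t, perm_eq s t & good t.
Proof.
have [m] := ubnP (size s); elim: m s => // m IHm s sm ss.
have [/size0nil ->|/(strict_max ss)[d [s' [ps ss' _]]]] := posnP (size s).
  by exists [::].
have [|t s't gt] := IHm s' _ ss'.
  by have := perm_size ps; rewrite /=; lia.
have pst : perm_eq s (d :: t) by rewrite (perm_trans ps) ?perm_cons.
by exists (d :: t) => //=; split=> //; apply: perm_strict ss.
Qed.

Lemma perm_count_mem (s t : seq nat) :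
  (forall r, count_mem r s = count_mem r t) -> perm_eq s t.
Proof. by move=> st; apply/allP => r _; apply/eqP/st. Qed.

(* Two removable corners in rows a > b: after removing both, the end of row
   a-1 is again a corner, and the end of the top row is still read before it,
   so that the word a b (a-1) d ... admits an unblocked exchange of a and b. *)
Lemma good_bridge a b t1 t2 :
    good (a :: t1) -> good (b :: t2) -> perm_eq (a :: t1) (b :: t2) -> b < a ->
  exists s, [/\ good [:: a, b & s], perm_eq t1 (b :: s),
                 knuth_step [:: a, b & s] [:: b, a & s] &
                 knuth_step [:: b, a & s] [:: a, b & s]].
Proof.
move=> [sa /good_strict s1] [_ /good_strict s2] /permP p12 ba.
case: a => // c in sa p12 ba *.
have := sa c; have := s2 c; have := p12 (pred1 c); have := p12 (pred1 c.+1).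
rewrite /= => e1 e2 h2 ha.
pose s0 : seq nat := rem c (rem b t1).
have cnt (r : nat) : count_mem r t1 = (b == r) + (c == r) + count_mem r s0.
  rewrite !count_mem_rem; have := p12 (pred1 b); rewrite /=.
  by case: (eqVneq b r) => ?; case: (eqVneq c r) => ?; subst; lia.
have [sc0 ss0] : strict (c :: s0) /\ strict s0.
  split=> r; have := s1 r; have := s2 r; have := sa r; have := p12 (pred1 r);
    have := p12 (pred1 r.+1); rewrite /= !cnt;
    by move: (count_mem r.+1 s0) (count_mem r s0) (count_mem _ t2)
      (count_mem _ t2) => *; lia.
(* The strict word [t2] still contains [c.+1], hence contains [c] at least twice, and [s0] has
   exactly one copy of [c] fewer. This makes the maximum [d] of [s0] at least [c], which unblocks
   the exchange. *)
have cs0 : c \in s0.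
  rewrite -has_pred1 has_count; move: (cnt c) e1 e2 h2 ha; rewrite !eqxx.
  by move: (count_mem c s0) (count_mem c t1) (count_mem c t2) (count_mem c.+1 t1)
    (count_mem c.+1 t2) => *; lia.
have [|d [s' [ps ss' maxd]]] := strict_max ss0; first by case: (s0) cs0.
have [q s'q gq] := good_exists ss'.
have cd : c <= d by apply: maxd.
have pq : perm_eq s0 (d :: q) by rewrite (perm_trans ps) ?perm_cons.
have p1 : perm_eq t1 [:: b, c, d & q].
  apply: perm_count_mem => r; rewrite cnt; move/permP: pq => /(_ (pred1 r)) -> /=.
  by rewrite -!addnA.
exists [:: c, d & q]; split=> //.
- rewrite /=; split; first by apply: perm_strict sa; rewrite perm_cons.
  split; first exact: perm_strict p1 s1.
  split; first by apply: perm_strict sc0; rewrite perm_cons.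
  by split=> //; apply: perm_strict ss0.
- have := KnuthStep [::] c.+1 b c d q; rewrite /= /restricted_knuth.
  rewrite ifF; last lia.
  by rewrite ifT //; lia.
- have := KnuthStep [::] b c.+1 c d q; rewrite /= /restricted_knuth.
  rewrite ifF; last lia.
  by rewrite ifT //; lia.
Qed.

Lemma good_bridge_neq a b t1 t2 :
    good (a :: t1) -> good (b :: t2) -> perm_eq (a :: t1) (b :: t2) -> b != a ->
  exists s, [/\ good [:: a, b & s], good [:: b, a & s], perm_eq t1 (b :: s),
    perm_eq (a :: s) t2 & knuth_step [:: a, b & s] [:: b, a & s]].
Proof.
move=> g1 g2 p12 nba.
have swap s : perm_eq [:: a, b & s] [:: b, a & s] by apply/permP => P /=; lia.
have [ba|ab|] := ltngtP b a; last by move=> e; rewrite e eqxx in nba.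
  have [s [gs ps ss' _]] := good_bridge g1 g2 p12 ba.
  exists s; split=> //; first exact: good_knuth_step gs.
  rewrite -(perm_cons b) -(permPl (swap s)); apply: perm_trans p12.
  by rewrite perm_cons perm_sym.
have p21 : perm_eq (b :: t2) (a :: t1) by rewrite perm_sym.
have [s [gs ps ss ss']] := good_bridge g2 g1 p21 ab.
exists s; split=> //; first exact: good_knuth_step gs; last by rewrite perm_sym.
rewrite -(perm_cons a) (permPr (swap s)) (permPl p12).
by rewrite perm_cons.
Qed.

Lemma good_connected t t' :
  good t -> good t' -> perm_eq t t' -> knuth_connected t t'.
Proof.
have [m] := ubnP (size t); elim: m t t' => // m IHm [|a t] [|b t'] szt gt gt' ptt';
  try exact: rt_refl; try by have := perm_size ptt'.
have IH s s' : size s = size t -> good s -> good s' -> perm_eq s s' ->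
    knuth_connected s s' by move=> sz; apply: IHm; rewrite sz.
case: (gt) (gt') => [_ gt1] [_ gt1'].
have [ab|nab] := eqVneq b a.
  by subst b; apply/knuth_connected_cons/IH => //; rewrite perm_cons in ptt'.
have [s [[_ gbs] [_ gas] ps ps' st]] := good_bridge_neq gt gt' ptt' nab.
(* The path has three legs: the induction hypothesis behind [a], the bridge, the induction
   hypothesis behind [b]. *)
apply: (@rt_trans _ _ _ [:: a, b & s]); first exact/knuth_connected_cons/IH.
apply: (@rt_trans _ _ _ [:: b, a & s]); first exact: rt_step.
by apply/knuth_connected_cons/IH => //; rewrite (perm_size ps).
Qed.

(** * Stable sorting, standardization and the action of [dR] *)

Definition fibers (f : nat -> nat) (k : nat) (s : seq nat) : seq (seq nat) :=
  [seq [seq v <- s | f v == r] | r <- iota 0 k].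

Lemma fibersS f k s :
  fibers f k.+1 s = rcons (fibers f k s) [seq v <- s | f v == k].
Proof. by rewrite /fibers -addn1 iotaD map_cat cats1. Qed.

Lemma nth_fibers f k s r :
  r < k -> nth [::] (fibers f k s) r = [seq v <- s | f v == r].
Proof. by move=> rk; rewrite (nth_map 0) ?size_iota // nth_iota. Qed.

Lemma perm_flatten_fibers f k s :
  all (fun v => f v < k) s -> perm_eq (flatten (fibers f k s)) s.
Proof.
move=> /all_filterP {2}<-; elim: k => [|k IHk]; first by elim: s.
rewrite fibersS flatten_rcons.
apply: (@perm_trans _ ([seq v <- s | f v < k] ++ [seq v <- s | f v == k])).
  by rewrite perm_cat2r.
apply/permP => P; rewrite count_cat !count_filter; elim: s {IHk} => //= v s.
by case: (P v); lia.
Qed.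

Definition lexi_lt (f : nat -> nat) : rel nat :=
  fun u v => (f u < f v) || ((f u == f v) && (u < v)).

Lemma lexi_lt_trans f : transitive (lexi_lt f).
Proof. by move=> v u w; rewrite /lexi_lt; lia. Qed.

(** Concatenating the fibers of an increasing list is a stable sort by [f]: values of [f] decide
    first, and ties keep the increasing order. *)
Lemma sorted_flatten_fibers f k s :
  sorted ltn s -> sorted (lexi_lt f) (flatten (fibers f k s)).
Proof.
move=> ss; rewrite (sorted_pairwise (@lexi_lt_trans f)).
elim: k => [|k IHk] //; rewrite fibersS flatten_rcons pairwise_cat IHk /=.
apply/andP; split.
  apply/allrelP => u v /flattenP[_ /mapP[r rk ->]]; move: rk; rewrite mem_iota => rk.
  by rewrite !mem_filter /lexi_lt => /andP[/eqP -> _] /andP[/eqP -> _]; lia.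
rewrite -(sorted_pairwise (@lexi_lt_trans f)).
have := sorted_filter ltn_trans (fun v => f v == k) ss.
apply: (sub_in_sorted (P := [pred v | f v == k])); last first.
  by apply/allP => v; rewrite mem_filter => /andP[].
by move=> u v /eqP fu /eqP fv uv; rewrite /lexi_lt fu fv eqxx uv orbT.
Qed.

Lemma index_flatten_fibers f k s u v :
    all (fun v => f v < k) s -> sorted ltn s -> u \in s -> v \in s ->
  (index u (flatten (fibers f k s)) < index v (flatten (fibers f k s))) =
  lexi_lt f u v.
Proof.
move=> fk ss us vs; set w := flatten _.
have pw : w =i s by apply/perm_mem/perm_flatten_fibers.
have idx x y : x \in s -> y \in s -> index x w < index y w -> lexi_lt f x y.
  move=> xs ys; have sw := sorted_flatten_fibers f k ss.
  by apply: (sorted_ltn_index (@lexi_lt_trans f) sw); rewrite pw.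
apply/idP/idP; first exact: idx.
move=> uv.
have [//|/(idx _ _ vs us)|/index_inj e] := ltngtP (index u w) (index v w).
  by move: uv; rewrite /lexi_lt; lia.
by move: uv; rewrite e ?pw // /lexi_lt; lia.
Qed.

(** The index [size t - v] is that of letter number n+1-v, counted from 0; that letter names the row
    of the entry [v], with rows counted from 0. *)
Definition tab (k : nat) (t : seq nat) : seq (seq nat) :=
  fibers (fun v => nth 0 t (size t - v)) k (iota 1 (size t)).

(** The inverse of the standardization of [t], equal letters being numbered from left to right. *)
Definition stdz (k : nat) (t : seq nat) : seq nat :=
  flatten (fibers (fun v => nth 0 t v.-1) k (iota 1 (size t))).

Lemma all_nth_iota k (t : seq nat) (g : nat -> nat) :
    all (fun x => x < k) t -> (forall v, 1 <= v <= size t -> g v < size t) ->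
  all (fun v => nth 0 t (g v) < k) (iota 1 (size t)).
Proof.
move=> tk gt; apply/allP => v; rewrite mem_iota => v1.
by apply: (allP tk); apply: mem_nth; apply: gt; lia.
Qed.

Lemma perm_tab k t :
  all (fun x => x < k) t -> perm_eq (flatten (tab k t)) (iota 1 (size t)).
Proof. by move=> tk; apply/perm_flatten_fibers/all_nth_iota => // v; lia. Qed.

Lemma perm_rw T : perm_eq (rw T) (flatten T).
Proof. by apply: perm_flatten; rewrite perm_rev. Qed.

Lemma rev_map_iota n : rev [seq n + 1 - v | v <- iota 1 n] = iota 1 n.
Proof.
apply: (@eq_from_nth _ 0); rewrite ?size_rev size_map size_iota // => i ilt.
rewrite nth_rev ?size_map ?size_iota // (nth_map 0) ?size_iota; last lia.
by rewrite !nth_iota; lia.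
Qed.

(** The reversal in [flip] undoes the top-down order of the rows. Inside a row, reversing and
    complementing turns the increasing entries into the increasing positions of one letter. *)
Lemma flip_rw_tab k t :
  all (fun x => x < k) t -> flip (rw (tab k t)) = stdz k t.
Proof.
move=> tk; rewrite /flip (perm_size (perm_rw _)) (perm_size (perm_tab tk)) size_iota.
rewrite /rw rev_flatten map_rev revK map_flatten /stdz /tab /fibers -!map_comp.
congr flatten; apply: eq_map => r /=.
rewrite -{2}rev_map_iota filter_rev filter_map map_rev; congr (rev (map _ _)).
apply: eq_in_filter => v; rewrite mem_iota /= => v1; congr (nth 0 t _ == r); lia.
Qed.

(** Since [a] and [b] differ, no fiber contains both positions, so exchanging the two consecutive
    values keeps every fiber increasing. *)
Lemma swap_stdz (k : nat) p (a b : nat) q : a != b ->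
  swap_values (size p).+1 (size p).+2 (stdz k (p ++ [:: a, b & q])) =
  stdz k (p ++ [:: b, a & q]).
Proof.
move=> ab; rewrite /swap_values /stdz map_flatten /fibers -!map_comp.
congr flatten; apply: eq_map => r /=.
rewrite !size_cat /= (iotaD 1 (size p)) !filter_cat !map_cat /= add1n !nth_cat /=.
rewrite ltnn subnn ltnNge leqnSn subSnn /=.
have outside (s : seq nat) (c d e g : nat) :
    (forall v : nat, v \in s -> 0 < v /\ (v <= size p \/ (size p).+2 < v)) ->
  [seq (if v == (size p).+1 then (size p).+2 else
        if v == (size p).+2 then (size p).+1 else v) |
     v <- [seq v <- s | nth 0 (p ++ [:: c, d & q]) v.-1 == r]] =
  [seq v <- s | nth 0 (p ++ [:: e, g & q]) v.-1 == r].
  move=> sout.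
  rewrite (@eq_in_filter _ _ (fun v => nth 0 (p ++ [:: e, g & q]) v.-1 == r)).
    rewrite -[RHS]map_id; apply/eq_in_map => v; rewrite mem_filter => /andP[_ /sout].
    by move=> ?; rewrite ifF ?ifF //; lia.
  move=> /= v /sout [v0 vout]; rewrite !nth_cat; case: ltnP => // pv.
  by have -> : v.-1 - size p = (v - (size p).+3).+2 by lia.
rewrite (outside _ _ _ b a) => [|v]; last by rewrite mem_iota; lia.
congr (_ ++ _).
have := outside (iota (size p).+3 (size q)) a b b a.
case: (eqVneq a r) (eqVneq b r) => [<-|_] [e|_] /=; first by rewrite e eqxx in ab.
all: rewrite ?eqxx ?(gtn_eqF (ltnSn _)) => -> // v; rewrite mem_iota; lia.
Qed.

(** The letters [x], [y], [z], [u] stand at the positions i-1, ..., i+2. Order of occurrence in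
    [stdz] is order of letters with ties broken by position, so each test in [d] and [ID] becomes an
    inequality between these letters. *)
Lemma dR_stdz (k : nat) (p : seq nat) (x y z u : nat) (q : seq nat) :
    all (fun v => v < k) (p ++ [:: x, y, z, u & q]) ->
  dR (size p).+2 (stdz k (p ++ [:: x, y, z, u & q])) =
  stdz k (p ++ restricted_knuth x y z u ++ q).
Proof.
set t := p ++ _ => tk; set i := (size p).+2.
have szt : size t = (size p + size q).+4 by rewrite size_cat /= !addnS.
have nthE (a b c e : nat) : let s := p ++ [:: a, b, c, e & q] in
    [/\ nth 0 s (size p) = a, nth 0 s (size p).+1 = b,
        nth 0 s (size p).+2 = c & nth 0 s (size p).+3 = e].
  have nthp m s : nth 0 (p ++ s) (m + size p) = nth 0 s m.
    by rewrite nth_cat ltnNge leq_addl addnK.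
  by split; [apply: (nthp 0) | apply: (nthp 1) | apply: (nthp 2) | apply: (nthp 3)].
have idx (s : seq nat) (a b : nat) : perm_eq s t -> 0 < a <= size t -> 0 < b <= size t ->
    (index a (stdz k s) < index b (stdz k s)) = lexi_lt (fun v => nth 0 s v.-1) a b.
  move=> st a1 b1; rewrite index_flatten_fibers ?iota_ltn_sorted //.
  - by apply: all_nth_iota => [|v]; [rewrite (perm_all _ st) | lia].
  - by rewrite mem_iota add1n ltnS (perm_size st).
  - by rewrite mem_iota add1n ltnS (perm_size st).
have IDi (a b c e : nat) : perm_eq (p ++ [:: a, b, c, e & q]) t ->
    (i.+1 \in ID (stdz k (p ++ [:: a, b, c, e & q]))) = (e < c).
  move=> st; rewrite inE idx //; try by rewrite szt /i; lia.
  have -> : size (stdz k (p ++ [:: a, b, c, e & q])) = size t.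
    rewrite -(perm_size st) -[RHS](size_iota 1); apply/perm_size/perm_flatten_fibers.
    by apply: all_nth_iota => [|v]; [rewrite (perm_all _ st) | lia].
  by have [_ _ /= e1 e2] := nthE a b c e; rewrite /lexi_lt /= e1 e2 szt /i; lia.
have [ex ey ez _] := nthE x y z u; rewrite -/t in ex ey ez.
have swy :
    y != z -> swap_values i i.+1 (stdz k t) = stdz k (p ++ [:: x, z, y, u & q]).
  move=> yz; have := swap_stdz k (rcons p x) (u :: q) yz.
  by rewrite !cat_rcons size_rcons.
have swx :
    x != y -> swap_values i.-1 i (stdz k t) = stdz k (p ++ [:: y, x, z, u & q]).
  exact: swap_stdz.
have yzP : perm_eq (p ++ [:: x, z, y, u & q]) t.
  by rewrite perm_cat2l; apply/permP => P /=; lia.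
have xyP : perm_eq (p ++ [:: y, x, z, u & q]) t.
  by rewrite perm_cat2l; apply/permP => P /=; lia.
have dE : d i (stdz k t) =
    if (y < x <= z) || (z < x <= y) then stdz k (p ++ [:: x, z, y, u & q])
    else if (y <= z < x) || (x <= z < y) then stdz k (p ++ [:: y, x, z, u & q])
    else stdz k t.
  rewrite /d /between !idx // ?szt /i; try lia.
  rewrite /lexi_lt /= ex ey ez.
  case: ifP => c1; first by rewrite ifT ?swy //; lia.
  have -> : (y < x <= z) || (z < x <= y) = false by lia.
  case: ifP => c2; first by rewrite ifT ?swx //; lia.
  by rewrite ifF //; lia.
rewrite /dR dE (IDi _ _ _ _ (perm_refl t)) /restricted_knuth.
case c1: ((y < x <= z) || (z < x <= y)) => /=.
  rewrite (IDi _ _ _ _ yzP); case: (_ && _) => //=.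
  by have -> : (y <= z < x) || (x <= z < y) = false by lia.
case c2: ((y <= z < x) || (x <= z < y)) => /=; last by rewrite if_same.
(* Exchanging [x] and [y] leaves [z] and [u] in place, so both descent conditions are the same. *)
by rewrite (IDi _ _ _ _ xyP) andbb; case: (u < z).
Qed.

(** * The correspondence between tableaux and good words *)

Definition encodes (lam t : seq nat) :=
  [/\ good t, size t = sumn lam & forall r, count_mem r t = nth 0 lam r].

Lemma encodes_bounded lam t : encodes lam t -> all (fun r => r < size lam) t.
Proof.
case=> _ _ ct; apply/allP => r rt; rewrite ltnNge; apply/negP => lr.
by move: rt; rewrite -has_pred1 has_count ct nth_default.
Qed.

(** The last [v] letters belong to the entries 1, ..., [v]. Thus suffixes of the word correspond to
    subtableaux, and [good] says that each of these has a strict shape. *)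
Lemma count_drop (t : seq nat) r v : v <= size t ->
  count_mem r (drop (size t - v) t) =
  count (fun w => w <= v) [seq w <- iota 1 (size t) | nth 0 t (size t - w) == r].
Proof.
move=> vt.
have -> : drop (size t - v) t =
    [seq nth 0 t (size t - w) | w <- rev (iota 1 v)].
  apply: (@eq_from_nth _ 0);
    rewrite size_drop subKn // ?size_map ?size_rev ?size_iota // => j jv.
  rewrite nth_drop (nth_map 0) ?size_rev ?size_iota // nth_rev ?size_iota //.
  by rewrite nth_iota; [congr nth|]; lia.
have -> : iota 1 v = [seq w <- iota 1 (size t) | w <= v].
  apply: (irr_sorted_eq ltn_trans ltnn); rewrite ?iota_ltn_sorted //.
    exact/sorted_filter/iota_ltn_sorted/ltn_trans.
  by move=> w; rewrite mem_filter !mem_iota; lia.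
rewrite count_map count_rev !count_filter; apply: eq_count => w /=.
by rewrite andbC.
Qed.

(** This translates between the column condition, which compares entries, and strictness of
    suffixes, which compares numbers of entries at most [v]. *)
Lemma count_le_sorted (s : seq nat) j v : sorted ltn s ->
  (j < count (fun w => w <= v) s) = (j < size s) && (nth 0 s j <= v).
Proof.
elim: s j => [|w s IHs] j; first by rewrite nth_nil.
move=> /[dup] /path_sorted /IHs {}IHs; rewrite /= (path_sortedE ltn_trans).
case/andP=> /allP wlt _; case: (leqP w v) => wv.
  by case: j => [|j]; rewrite //= add1n !ltnS.
have -> : count (fun x => x <= v) s = 0.
  by apply/eqP; rewrite -leqn0 leqNgt -has_count; apply/hasPn => x /wlt; lia.
case: j => [|j] /=; first by lia.
by symmetry; apply/negP => /andP[js]; have /wlt /= := mem_nth 0 js; lia.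
Qed.

Lemma strict_partition_decr n lam r :
  strict_partition n lam -> r.+1 < size lam -> nth 0 lam r.+1 < nth 0 lam r.
Proof. by case=> /(sortedP 0) lamS _ _ /lamS. Qed.

Lemma SSYT_tab n lam t :
  strict_partition n lam -> encodes lam t -> SSYT lam (tab (size lam) t).
Proof.
move=> lamP tE; have tk := encodes_bounded tE; case: tE => gt szt ct.
have szr r :
    size [seq v <- iota 1 (size t) | nth 0 t (size t - v) == r] = nth 0 lam r.
  have := count_drop r (leqnn (size t)); rewrite subnn drop0 -ct => ->.
  rewrite count_filter size_filter.
  by apply: eq_in_count => v; rewrite mem_iota /=; lia.
have srt r : sorted ltn [seq v <- iota 1 (size t) | nth 0 t (size t - v) == r].
  exact/sorted_filter/iota_ltn_sorted/ltn_trans.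
split.
- apply: (@eq_from_nth _ 0); rewrite ?size_map size_iota // => r rk.
  by rewrite (nth_map [::]) ?nth_fibers // size_map size_iota.
- by rewrite -szt; apply: perm_tab.
- move=> r c /andP[rk rc] /andP[_ rc1]; rewrite /entry nth_fibers; last lia.
  by apply: (sorted_ltn_nth ltn_trans 0 (srt _)); rewrite ?inE ?szr; lia.
- move=> r c /andP[r1 rc] /andP[r2 rc2]; rewrite /entry !nth_fibers /=; try lia.
  set Ru := [seq v <- _ | _ == r]; set Rd := [seq v <- _ | _ == r.-1].
  (* Each row starts on the diagonal, so the cell below the one of index [j] has index [j.+1] in its
     own row. *)
  pose j := c - r.+1; have cj : c - r = j.+1 by rewrite /j; lia.
  have jR : j < size Ru by rewrite szr /j; move: rc2 => /=; lia.
  have vR := mem_nth 0 jR; rewrite -/j cj; set v := nth 0 Ru j in vR *.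
  move: vR; rewrite mem_filter mem_iota => /andP[/eqP vr v1].
  have vt : v <= size t by lia.
  have : j < count (fun w => w <= v) Ru.
    by rewrite count_le_sorted ?srt // jR /v leqnn.
  rewrite -count_drop // => jc.
  have rr : r = r.-1.+1 by lia.
  (* Strictness of the suffix of length [v] gives the lower row at least j+2 entries at most [v], so
     its entry of index [j.+1] is at most [v]; equality fails because [v] lies in the upper row. *)
  have /goodP gd := gt; have := gd (size t - v) r.-1; rewrite -rr => sdrop.
  have : j.+1 < count (fun w => w <= v) Rd by rewrite -count_drop //; lia.
  rewrite count_le_sorted ?srt // => /andP[jd].
  rewrite leq_eqVlt => /orP[/eqP e|//].
  have := mem_nth 0 jd; rewrite e mem_filter vr => /andP[/eqP]; lia.
Qed.

Lemma flatten_uniq_nth (T : seq (seq nat)) v r r' : uniq (flatten T) ->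
  v \in nth [::] T r -> v \in nth [::] T r' -> r = r'.
Proof.
elim: T r r' => [|R T IHT] r r'; first by rewrite nth_nil.
rewrite /= cat_uniq => /and3P[_ /hasPn RT uT].
have inT j : v \in nth [::] T j -> v \in flatten T.
  move=> vj; apply/flattenP; exists (nth [::] T j) => //; apply: mem_nth.
  by rewrite ltnNge; apply: contraL vj => jT; rewrite nth_default.
case: r r' => [|r] [|r'] //=.
- by move=> vR /inT /RT; rewrite vR.
- by move=> /inT /RT /negP nR /nR.
- by move=> vr /(IHT _ _ uT vr) ->.
Qed.

Lemma SSYT_encodes n lam T : strict_partition n lam -> SSYT lam T ->
  exists2 t, encodes lam t & T = tab (size lam) t.
Proof.
move=> lamP [shT pT rowT colT].
pose f v := find (fun row : seq nat => v \in row) T.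
(* The rows are listed for the entries in decreasing order, so the entry [v] has index [m - v] in
   [t]. *)
pose m := sumn lam; pose t := rev [seq f v | v <- iota 1 m].
have szt : size t = m by rewrite size_rev size_map size_iota.
have szT : size T = size lam by rewrite -shT size_map.
have szr r : size (nth [::] T r) = nth 0 lam r by rewrite -shT nth_shape.
have nt v : 1 <= v <= m -> nth 0 t (m - v) = f v.
  move=> v1; rewrite nth_rev size_map size_iota; last lia.
  rewrite (nth_map 0) ?size_iota ?nth_iota; try lia.
  by congr f; lia.
have srt r : sorted ltn (nth [::] T r).
  apply/(sortedP 0) => j; rewrite szr => jr.
  have rk : r < size lam.
    by rewrite ltnNge; apply: contraL jr => kr; rewrite nth_default.
  have := rowT r.+1 (j + r.+1); rewrite /entry /in_shifted_shape /= -addSn !addnK.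
  by apply; lia.
have uT : uniq (flatten T) by rewrite (perm_uniq pT) iota_uniq.
have TE : T = tab (size lam) t.
  apply: (@eq_from_nth _ [::]); first by rewrite size_map size_iota.
  move=> r; rewrite szT => rk; rewrite nth_fibers //.
  apply: (irr_sorted_eq ltn_trans ltnn) => //.
    exact/sorted_filter/iota_ltn_sorted/ltn_trans.
  move=> v; rewrite mem_filter szt; apply/idP/andP => [vr|[/eqP <-]].
    have vT : v \in flatten T.
      by apply/flattenP; exists (nth [::] T r); rewrite ?mem_nth ?szT.
    have := vT; rewrite (perm_mem pT) => vm; split=> //; rewrite mem_iota in vm.
    rewrite nt; last by lia.
    have hv : has (fun row : seq nat => v \in row) T.
      by apply/hasP; exists (nth [::] T r); rewrite ?mem_nth ?szT.
    by apply/eqP/(flatten_uniq_nth uT _ vr)/(nth_find [::] hv).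
  move=> vm; have := vm; rewrite mem_iota => v1.
  rewrite nt; last by rewrite /m; lia.
  apply: (nth_find [::] (a := fun row : seq nat => v \in row)).
  move: vm; rewrite -(perm_mem pT) => /flattenP[R RT vR].
  by apply/hasP; exists R.
exists t => //.
have cd r v : v <= m ->
    count_mem r (drop (m - v) t) = count (fun w => w <= v) (nth [::] T r).
  move=> vm; rewrite -{1}szt count_drop ?szt //.
  have [rk|kr] := ltnP r (size lam); first by rewrite TE nth_fibers ?szt.
  rewrite [nth _ _ _]nth_default ?szT //= -size_filter -filter_predI.
  apply/eqP; rewrite size_filter -leqn0 leqNgt -has_count; apply/hasPn => w.
  rewrite mem_iota /= => w1; rewrite nt; last lia.
  have : f w < size T.
    rewrite -has_find; have : w \in flatten T by rewrite (perm_mem pT) mem_iota.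
    by case/flattenP=> R RT wR; apply/hasP; exists R.
  by rewrite szT; lia.
split=> //.
  apply/goodP => j r; have [jm|mj] := leqP j m; last first.
    by left; rewrite drop_oversize ?szt // ltnW.
  rewrite -(subKn jm) !cd ?leq_subr //; set v := m - j.
  (* If the upper row has i+1 entries at most [v], the last has index [i]. The cell below it has
     index i+1, exists because [lam] is strictly decreasing, and holds a smaller entry, so the lower
     row has at least i+2 such entries. *)
  case E : (count _ (nth [::] T r.+1)) => [|i]; first by left.
  right; have : i < count (fun w => w <= v) (nth [::] T r.+1) by rewrite E.
  rewrite !count_le_sorted // !szr => /andP[ir iv].
  have rk : r.+1 < size lam.
    by rewrite ltnNge; apply: contraL ir => kr; rewrite nth_default.
  have dec := strict_partition_decr lamP rk.
  have := colT r.+1 (i + r.+2); rewrite /entry /in_shifted_shape /= addnK -addSnnS addnK.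
  move=> H; rewrite (leq_ltn_trans ir dec) (leq_trans _ iv) //.
  by apply/ltnW/H; lia.
move=> r; have := cd r m (leqnn m); rewrite subnn drop0 -szr => ->.
apply/eqP; rewrite -all_count.
apply/allP => v vr; have : v \in flatten T.
  apply/flattenP; exists (nth [::] T r) => //; apply: mem_nth.
  by rewrite ltnNge; apply: contraL vr => kr; rewrite nth_default.
by rewrite (perm_mem pT) mem_iota /m; lia.
Qed.

(** * Transfer of the moves from words to tableaux *)

Lemma encodes_step lam t t' : knuth_step t t' -> encodes lam t -> encodes lam t'.
Proof.
move=> st [gt szt ct]; have pt := perm_knuth_step st.
split; first exact: good_knuth_step gt.
  by rewrite -szt (perm_size pt).
by move=> r; rewrite -ct; move/permP: pt.
Qed.

Lemma dR_image_tab n lam p x y z u q :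
    let t := p ++ [:: x, y, z, u & q] in
    let t' := p ++ restricted_knuth x y z u ++ q in
    strict_partition n lam -> encodes lam t ->
  dR_image lam (size p).+2 (tab (size lam) t) (tab (size lam) t').
Proof.
move=> t t' lamP tE; have t'E : encodes lam t' by apply: encodes_step tE.
split; first exact: SSYT_tab lamP t'E.
by rewrite !flip_rw_tab ?encodes_bounded // -dR_stdz ?encodes_bounded.
Qed.

(** Complementing the values once more undoes [flip] up to reversal, and the fixed shape tells where
    to cut the reading word into rows. Uniqueness of the image follows. *)
Lemma flip_rw_inj lam T T' :
  SSYT lam T -> SSYT lam T' -> flip (rw T) = flip (rw T') -> T = T'.
Proof.
have flipK U : SSYT lam U ->
    [seq sumn lam + 1 - v | v <- flip (rw U)] = rev (rw U).
  move=> [_ pU _ _]; rewrite /flip -map_comp (perm_size (perm_rw U)).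
  rewrite (perm_size pU) size_iota.
  rewrite -[RHS]map_id; apply/eq_in_map => v.
  rewrite mem_rev (perm_mem (perm_rw U)) (perm_mem pU) mem_iota /=; lia.
move=> TS TS' eTT'; have := flipK T TS; rewrite eTT' flipK // => /(can_inj revK)/esym eTT.
case: TS TS' => shT _ _ _ [shT' _ _ _].
apply/(can_inj revK)/eq_from_flatten_shape => //.
by rewrite /shape !map_rev -/(shape T) -/(shape T') shT shT'.
Qed.

Lemma dR_connected_tab n lam t t' : strict_partition n lam ->
    knuth_connected t t' -> encodes lam t ->
  encodes lam t' /\
  clos_refl_trans _ (dR_move lam) (tab (size lam) t) (tab (size lam) t').
Proof.
move=> lamP; elim=> [_ _ [p x y z u q]|s|s s' s'' _ IH _ IH'] tE.
- split; first exact: encodes_step tE.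
  apply: rt_step; split; first exact: SSYT_tab lamP tE.
  exists (size p).+2; last exact: dR_image_tab lamP tE.
  by case: tE => _ <- _; rewrite size_cat /=; lia.
- by split=> //; apply: rt_refl.
- by have [/IH'[E H'] H] := IH tE; split=> //; apply: rt_trans H H'.
Qed.

Theorem proposition4p8 (n : nat) (lam : seq nat)
    (Hlam : strict_partition n lam) :
  (forall (i : nat) (T : seq (seq nat)), 2 <= i <= n - 2 -> SSYT lam T ->
     exists! T' : seq (seq nat), dR_image lam i T T')
  /\
  (forall T U : seq (seq nat), SSYT lam T -> SSYT lam U ->
     clos_refl_trans (seq (seq nat)) (dR_move lam) T U).
Proof.
split=> [i T i2 /(SSYT_encodes Hlam)[t tE ->]|T U].
  have [T' T'P] : exists T', dR_image lam i (tab (size lam) t) T'.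
    have [_ szt _] := tE; have [_ _ lamn] := Hlam.
    (* The move acts on the letters from index [i - 2] on; the bound on [i] leaves at least four of
       them, as [restricted_knuth] requires. *)
    have szd : size (drop (i - 2) t) = n - i + 2 by rewrite size_drop; lia.
    have szp : i = (size (take (i - 2) t)).+2.
      by rewrite size_takel; lia.
    move: szd tE; rewrite -{2 3}(cat_take_drop (i - 2) t).
    case: (drop _ _) => [|x [|y [|z [|u q]]]] /= szd tE; try lia.
    by rewrite {1}szp; eexists; apply: dR_image_tab Hlam tE.
  exists T'; split=> // T'' [T''S eT'']; case: T'P => T'S eT'.
  by apply: (flip_rw_inj T'S T''S); rewrite eT' eT''.
move=> /(SSYT_encodes Hlam)[t tE ->] /(SSYT_encodes Hlam)[t' t'E ->].
apply: (proj2 (dR_connected_tab Hlam _ tE)).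
case: tE t'E => gt _ ct [gt' _ ct']; apply: good_connected => //.
by apply: perm_count_mem => r; rewrite ct ct'.
Qed.
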